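(* Let $\pi$ be a log-concave probability mass function on $\mathcal{X}=\{0,\ldots,n\}$. Let $K_\pi$ have (death, hold, birth) probabilities $(q_i,r_i,p_i)$ given for $i\in\mathcal{X}$ by $$q_i=\frac{\pi_{i-1}}{\pi_{i-1}+\pi_i},\qquad r_i=\frac{\pi_i^2-\pi_{i-1}\pi_{i+1}}{(\pi_{i-1}+\pi_i)(\pi_i+\pi_{i+1})},\qquad p_i=\frac{\pi_{i+1}}{\pi_i+\pi_{i+1}},$$ with $\pi_{-1}:=0$ and $\pi_{n+1}:=0$. Then $K_\pi$ is a stochastically monotone birth-and-death kernel with stationary distribution $\pi$, and $K_\pi\preceq K$ for every stochastically monotone birth-and-death kernel $K$ on $\mathcal{X}$ with stationary distribution $\pi$.
   Context: $n$ is a positive integer and $\mathcal{X}=\{0,\ldots,n\}$ has its usual linear order. Throughout, $\pi_i>0$ for all $i\in\mathcal{X}$; log-concave means $\pi_i^2\ge\pi_{i-1}\pi_{i+1}$ for $0<i<n$. A birth-and-death kernel on $\mathcal{X}$ is a Markov kernel $K$ with $K(i,j)=0$ whenever $|i-j|>1$; its death, hold and birth probabilities are $q_i=K(i,i-1)$, $r_i=K(i,i)$, $p_i=K(i,i+1)$ (with $q_0=p_n=0$). Let $\mathcal{M}$ be the set of nonnegative nonincreasing functions on $\mathcal{X}$, $(Kf)(i)=\sum_jK(i,j)f(j)$, and $\langle f,g\rangle=\sum_i\pi_if(i)g(i)$. $K$ is stochastically monotone if $Kf\in\mathcal{M}$ for every $f\in\mathcal{M}$. For Markov kernels $K,L$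 with stationary distribution $\pi$, $K\preceq L$ means $\langle Kf,g\rangle\le\langle Lf,g\rangle$ for all $f,g\in\mathcal{M}$. *)

(* Defs.v *)
From mathcomp Require Import all_boot all_order all_algebra.

Set Implicit Arguments.
Unset Strict Implicit.
Unset Printing Implicit Defensive.

Import Order.TTheory GRing.Theory Num.Theory.
Local Open Scope ring_scope.

(* The state space {0, ..., n} is 'I_n.+1.  Probability distributions are row
   vectors, functions are column vectors and kernels are square matrices, so
   that Kf is K *m f and the law pi K is pi *m K. *)

(* The value pi_k for an arbitrary integer k, with pi_k = 0 for k outside
   {0, ..., n}. *)
Definition pi_at (R : realFieldType) (n : nat) (pi : 'rV[R]_n.+1) (k : int) : R :=
  if k is Posz m then oapp (pi 0) 0 (insub m) else 0.

Definition positive_pmf (R : realFieldType) (n : nat) (pi : 'rV[R]_n.+1) : Prop :=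
  (forall i, 0 < pi 0 i) /\ \sum_i pi 0 i = 1.

Definition log_concave (R : realFieldType) (n : nat) (pi : 'rV[R]_n.+1) : Prop :=
  forall i : 'I_n.+1, (0 < i < n)%N ->
    pi_at pi (i%:Z - 1) * pi_at pi (i%:Z + 1) <= pi_at pi i%:Z ^+ 2.

Definition markov_kernel (R : realFieldType) (n : nat) (K : 'M[R]_n.+1) : Prop :=
  (forall i j, 0 <= K i j) /\ (forall i, \sum_j K i j = 1).

Definition birth_death (R : realFieldType) (n : nat) (K : 'M[R]_n.+1) : Prop :=
  markov_kernel K /\
  (forall i j : 'I_n.+1, 1 < `|i%:Z - j%:Z| -> K i j = 0).

Definition stationary (R : realFieldType) (n : nat)
    (pi : 'rV[R]_n.+1) (K : 'M[R]_n.+1) : Prop :=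
  pi *m K = pi.

Definition in_M (R : realFieldType) (n : nat) (f : 'cV[R]_n.+1) : Prop :=
  (forall i, 0 <= f i 0) /\
  (forall i j : 'I_n.+1, (i <= j)%N -> f j 0 <= f i 0).

Definition stoch_monotone (R : realFieldType) (n : nat) (K : 'M[R]_n.+1) : Prop :=
  forall f : 'cV[R]_n.+1, in_M f -> in_M (K *m f).

Definition inner (R : realFieldType) (n : nat)
    (pi : 'rV[R]_n.+1) (f g : 'cV[R]_n.+1) : R :=
  \sum_i pi 0 i * f i 0 * g i 0.

(* The comparison K <= L; it is meant for Markov kernels K and L having pi as
   stationary distribution. *)
Definition kernel_le (R : realFieldType) (n : nat)
    (pi : 'rV[R]_n.+1) (K L : 'M[R]_n.+1) : Prop :=
  forall f g : 'cV[R]_n.+1, in_M f -> in_M g ->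
    inner pi (K *m f) g <= inner pi (L *m f) g.

Definition death_prob (R : realFieldType) (n : nat)
    (pi : 'rV[R]_n.+1) (i : int) : R :=
  pi_at pi (i - 1) / (pi_at pi (i - 1) + pi_at pi i).

Definition hold_prob (R : realFieldType) (n : nat)
    (pi : 'rV[R]_n.+1) (i : int) : R :=
  (pi_at pi i ^+ 2 - pi_at pi (i - 1) * pi_at pi (i + 1)) /
  ((pi_at pi (i - 1) + pi_at pi i) * (pi_at pi i + pi_at pi (i + 1))).

Definition birth_prob (R : realFieldType) (n : nat)
    (pi : 'rV[R]_n.+1) (i : int) : R :=
  pi_at pi (i + 1) / (pi_at pi i + pi_at pi (i + 1)).

Definition K_of (R : realFieldType) (n : nat) (pi : 'rV[R]_n.+1) : 'M[R]_n.+1 :=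
  \matrix_(i, j)
    if j.+1 == i :> nat then death_prob pi i%:Z
    else if j == i then hold_prob pi i%:Z
    else if j == i.+1 :> nat then birth_prob pi i%:Z
    else 0.

(* Main.v *)
Require Import Defs.
From mathcomp Require Import all_boot all_order all_algebra.
From mathcomp Require Import zify ring lra.

Set Implicit Arguments.
Unset Strict Implicit.
Unset Printing Implicit Defensive.

Import Order.TTheory GRing.Theory Num.Theory.
Local Open Scope ring_scope.

(** A kernel [K] that is reversible with respect to [pi] satisfies
      <f, g> - <K f, g> = 1/2 sum_(i,j) pi_i K_ij (f_i - f_j) (g_i - g_j),
    and each product (f_i - f_j) (g_i - g_j) is nonnegative when [f] and [g]
    are both nonincreasing.  Among reversible kernels, <K f, g> is therefore
    smallest for the kernel with the largest off-diagonal entries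
    ([reversible_kernel_le]).

    Two facts turn this into the theorem.  A stationary birth-and-death chain
    is automatically reversible, since the flows across the cut between i and
    i + 1 balance ([stationary_birth_death_reversible]).  A birth-and-death
    kernel is stochastically monotone exactly when
    K(i, i+1) + K(i+1, i) <= 1 for all i ([stoch_monotone_add_le1],
    [birth_death_stoch_monotone]).  Together with reversibility this
    inequality reads K(i, i+1) <= pi_(i+1) / (pi_i + pi_(i+1)), and
    symmetrically for K(i+1, i).  [K_of pi] attains all these bounds at once:
    its off-diagonal entries are as large as monotonicity permits, and
    log-concavity of [pi] is what keeps its hold probabilities nonnegative. *)

(** * Reversible kernels *)

Definition reversible (R : realFieldType) (n : nat)
    (pi : 'rV[R]_n.+1) (K : 'M[R]_n.+1) : Prop :=
  forall i j, pi 0 i * K i j = pi 0 j * K j i.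

Lemma reversible_stationary (R : realFieldType) (n : nat)
    (pi : 'rV[R]_n.+1) (K : 'M[R]_n.+1) :
  markov_kernel K -> reversible pi K -> stationary pi K.
Proof.
move=> [_ K1] rK; apply/rowP => j; rewrite mxE.
by under eq_bigr do rewrite rK; rewrite -mulr_sumr K1 mulr1.
Qed.

(** The Dirichlet form.  Expanding the products leaves two diagonal terms,
    each equal to <f, g> because the rows of [K] sum to 1, and two cross terms
    each equal to <K f, g>; reversibility exchanges the members of each pair. *)
Lemma reversible_dirichlet (R : realFieldType) (n : nat)
    (pi : 'rV[R]_n.+1) (K : 'M[R]_n.+1) (f g : 'cV[R]_n.+1) :
  markov_kernel K -> reversible pi K ->
  \sum_i \sum_j pi 0 i * K i j * ((f i 0 - f j 0) * (g i 0 - g j 0)) =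
  (inner pi f g - inner pi (K *m f) g) *+ 2.
Proof.
move=> [_ K1] rK.
have diag : \sum_i \sum_j pi 0 i * K i j * (f i 0 * g i 0) = inner pi f g.
  apply: eq_bigr => i _.
  by rewrite -mulr_suml -mulr_sumr K1 mulr1 mulrA.
have diag' : \sum_i \sum_j pi 0 i * K i j * (f j 0 * g j 0) = inner pi f g.
  rewrite exchange_big /= -diag; apply: eq_bigr => i _.
  by apply: eq_bigr => j _; rewrite rK.
have cross : \sum_i \sum_j pi 0 i * K i j * (f j 0 * g i 0) =
    inner pi (K *m f) g.
  apply: eq_bigr => i _; rewrite mxE mulr_sumr mulr_suml.
  by apply: eq_bigr => j _; rewrite !mulrA.
have cross' : \sum_i \sum_j pi 0 i * K i j * (f i 0 * g j 0) =
    inner pi (K *m f) g.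
  rewrite exchange_big /= -cross; apply: eq_bigr => i _.
  by apply: eq_bigr => j _; rewrite rK.
have -> : (inner pi f g - inner pi (K *m f) g) *+ 2 =
  inner pi f g + inner pi f g - inner pi (K *m f) g - inner pi (K *m f) g.
  by ring.
rewrite -{1}diag -diag' -{1}cross -cross' -big_split -!sumrB /=.
apply: eq_bigr => i _; rewrite -big_split -!sumrB /=.
by apply: eq_bigr => j _; ring.
Qed.

Lemma in_M_mul_ge0 (R : realFieldType) (n : nat) (f g : 'cV[R]_n.+1)
    (i j : 'I_n.+1) :
  in_M f -> in_M g -> 0 <= (f i 0 - f j 0) * (g i 0 - g j 0).
Proof.
move=> [_ fM] [_ gM]; case: (leqP i j) => [le_ij | /ltnW le_ji].
  by rewrite mulr_ge0 ?subr_ge0 ?fM ?gM.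
by rewrite mulr_le0 ?subr_le0 ?fM ?gM.
Qed.

(** The analogue of the Peskun ordering for pairs of monotone functions.  Only
    off-diagonal entries enter, as f_i - f_j vanishes for i = j. *)
Lemma reversible_kernel_le (R : realFieldType) (n : nat)
    (pi : 'rV[R]_n.+1) (K L : 'M[R]_n.+1) :
  (forall i, 0 <= pi 0 i) ->
  markov_kernel K -> reversible pi K -> markov_kernel L -> reversible pi L ->
  (forall i j, i != j -> L i j <= K i j) -> kernel_le pi K L.
Proof.
move=> pi_ge0 mK rK mL rL leLK f g fM gM.
rewrite -(lerD2r (- inner pi f g)) -lerN2 !opprB -(ler_pMn2r (isT : (0 < 2)%N)).
rewrite -!reversible_dirichlet //.
apply: ler_sum => i _; apply: ler_sum => j _.
have [-> | ne_ij] := eqVneq i j; first by rewrite subrr mul0r !mulr0.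
by rewrite ler_wpM2r ?in_M_mul_ge0 // ler_wpM2l ?leLK.
Qed.

(** * Birth-and-death kernels *)

(** The mass of a set [P] is preserved by one step, so the flows out of [P]
    and into [P] agree. *)
Lemma stationary_cut (R : realFieldType) (n : nat)
    (pi : 'rV[R]_n.+1) (K : 'M[R]_n.+1) (P : pred 'I_n.+1) :
  markov_kernel K -> stationary pi K ->
  \sum_(i | P i) \sum_(j | ~~ P j) pi 0 i * K i j =
  \sum_(i | ~~ P i) \sum_(j | P j) pi 0 i * K i j.
Proof.
move=> [_ K1] sK.
have out : \sum_(i | P i) pi 0 i =
    \sum_(i | P i) \sum_(j | P j) pi 0 i * K i j +
    \sum_(i | P i) \sum_(j | ~~ P j) pi 0 i * K i j.
  rewrite -big_split /=; apply: eq_bigr => i _.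
  by rewrite -[LHS]mulr1 -(K1 i) mulr_sumr (bigID P).
have into : \sum_(i | P i) pi 0 i =
    \sum_(i | P i) \sum_(j | P j) pi 0 i * K i j +
    \sum_(i | ~~ P i) \sum_(j | P j) pi 0 i * K i j.
  transitivity (\sum_(j | P j) \sum_i pi 0 i * K i j).
    by apply: eq_bigr => j _; rewrite -[in LHS]sK mxE.
  by rewrite exchange_big /= (bigID P).
by apply: (addrI (\sum_(i | P i) \sum_(j | P j) pi 0 i * K i j)); rewrite -out.
Qed.

Lemma birth_death_far (R : realFieldType) (n : nat) (K : 'M[R]_n.+1)
    (i j : 'I_n.+1) :
  birth_death K -> ((i.+1 < j) || (j.+1 < i))%N -> K i j = 0.
Proof. by move=> [_ K0] far; apply: K0; lia. Qed.

Lemma stationary_birth_death_reversible (R : realFieldType) (n : nat)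
    (pi : 'rV[R]_n.+1) (K : 'M[R]_n.+1) :
  birth_death K -> stationary pi K -> reversible pi K.
Proof.
move=> bdK sK.
have adj (i j : 'I_n.+1) : j = i.+1 :> nat -> pi 0 i * K i j = pi 0 j * K j i.
  move=> ji.
  (* The only edge across the cut below [i.+1] is the one joining [i], [j]. *)
  have := stationary_cut (fun k : 'I_n.+1 => (k <= i)%N) (proj1 bdK) sK.
  rewrite (bigD1 i) //= (bigD1 j) /=; last by rewrite ji ltnn.
  rewrite big1 => [|l /andP[li lj]]; last first.
    rewrite (birth_death_far bdK) ?mulr0 //.
    by move: li lj; rewrite -val_eqE /=; lia.
  rewrite big1 => [|k /andP[ki ne_ki]]; last first.
    rewrite big1 // => l li; rewrite (birth_death_far bdK) ?mulr0 //.
    by move: ne_ki ki li; rewrite -val_eqE /=; lia.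
  rewrite (bigD1 j) /=; last by rewrite ji ltnn.
  rewrite (bigD1 i) //= big1 => [|l /andP[li lj]]; last first.
    rewrite (birth_death_far bdK) ?mulr0 //.
    by move: li lj; rewrite -val_eqE /=; lia.
  rewrite big1 => [|k /andP[ki ne_kj]]; last first.
    rewrite big1 // => l li; rewrite (birth_death_far bdK) ?mulr0 //.
    by move: ne_kj ki li; rewrite -val_eqE /=; lia.
  by rewrite !addr0.
move=> i j; have [far | near] := boolP ((i.+1 < j) || (j.+1 < i))%N.
  by rewrite !(birth_death_far bdK) ?mulr0 // orbC.
case: (ltngtP i j) => [lt_ij | lt_ji | /val_inj -> //].
  by apply: adj; lia.
by apply/esym/adj; lia.
Qed.

(** For i < j, apply [K] to the indicator of {0, ..., i}: its value at i is at
    most 1 - K i j and its value at j is at least K j i. *)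
Lemma stoch_monotone_add_le1 (R : realFieldType) (n : nat) (K : 'M[R]_n.+1) :
  markov_kernel K -> stoch_monotone K ->
  forall i j, i != j -> K i j + K j i <= 1.
Proof.
move=> [K_ge0 K1] smK.
have lt_case (i j : 'I_n.+1) : (i < j)%N -> K i j + K j i <= 1.
  move=> lt_ij.
  pose f : 'cV[R]_n.+1 := \col_k (k <= i)%N%:R.
  have fM : in_M f.
    split=> [k | k l le_kl]; rewrite !mxE ?ler0n // ler_nat.
    by case: (leqP l i) => // le_li; rewrite (leq_trans le_kl le_li).
  have := (smK f fM).2 i j (ltnW lt_ij); rewrite !mxE => le_Kf.
  have Kfj : K j i <= \sum_l K j l * f l 0.
    rewrite (bigD1 i) //= mxE leqnn mulr1 lerDl sumr_ge0 // => l _.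
    by rewrite mxE mulr_ge0 ?ler0n.
  have Kfi : K i j + \sum_l K i l * f l 0 <= 1.
    rewrite -(K1 i) (bigD1 j) //= [leRHS](bigD1 j) //=.
    rewrite mxE leqNgt lt_ij mulr0 add0r lerD2l ler_sum // => l _.
    by rewrite mxE ler_piMr // lern1 leq_b1.
  lra.
move=> i j; rewrite -val_eqE /= neq_ltn => /orP[] lt; first exact: lt_case.
by rewrite addrC lt_case.
Qed.

(** With f_i >= f_(i+1), keeping only the upward move gives
      (K f)_i >= (1 - K(i, i+1)) f_i + K(i, i+1) f_(i+1),
    and keeping only the downward move bounds (K f)_(i+1) from above; the
    hypothesis puts the two bounds in the right order. *)
Lemma birth_death_stoch_monotone (R : realFieldType) (n : nat)
    (K : 'M[R]_n.+1) :
  birth_death K ->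
  (forall i j : 'I_n.+1, j = i.+1 :> nat -> K i j + K j i <= 1) ->
  stoch_monotone K.
Proof.
move=> bdK leK f [f_ge0 fM]; have [[K_ge0 K1] _] := bdK.
have shift (i : 'I_n.+1) c : (K *m f) i 0 - c = \sum_l K i l * (f l 0 - c).
  rewrite mxE; under [RHS]eq_bigr do rewrite mulrBr.
  by rewrite sumrB -mulr_suml K1 mul1r.
have adj (i j : 'I_n.+1) : j = i.+1 :> nat -> (K *m f) j 0 <= (K *m f) i 0.
  move=> ji.
  have lowi : K i j * (f j 0 - f i 0) <= (K *m f) i 0 - f i 0.
    rewrite shift (bigD1 j) //= lerDl sumr_ge0 // => l ne_lj.
    case: (leqP l i) => [le_li | lt_il].
      by rewrite mulr_ge0 ?subr_ge0 ?fM.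
    rewrite (birth_death_far bdK) ?mul0r //.
    by move: ne_lj; rewrite -val_eqE /=; lia.
  have upj : (K *m f) j 0 - f j 0 <= K j i * (f i 0 - f j 0).
    rewrite shift (bigD1 i) //= gerDl sumr_le0 // => l ne_li.
    case: (leqP j l) => [le_jl | lt_lj].
      by rewrite mulr_ge0_le0 ?subr_le0 ?fM.
    rewrite (birth_death_far bdK) ?mul0r //.
    by move: ne_li; rewrite -val_eqE /=; lia.
  have le_ij : (i <= j)%N by rewrite ji.
  have := leK i j ji; have := fM i j le_ij.
  nra.
split=> [i | i j le_ij].
  by rewrite mxE sumr_ge0 // => j _; rewrite mulr_ge0.
move: {2}(j - i)%N (erefl (j - i)%N) => d; elim: d => [|d IHd] in j le_ij *.
  by move=> dij; have -> : j = i by apply: val_inj => /=; lia.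
move=> dij; have lt_jn : (j.-1 < n.+1)%N by have := ltn_ord j; lia.
apply: (@le_trans _ _ ((K *m f) (Ordinal lt_jn) 0)).
  by apply: adj => /=; lia.
by apply: IHd => /=; lia.
Qed.

(** * The kernel attached to a log-concave distribution *)

Section ExtremalKernel.

Variables (R : realFieldType) (n : nat) (pi : 'rV[R]_n.+1).
Hypothesis pi_gt0 : forall i, 0 < pi 0 i.

Lemma pi_at_ord (i : 'I_n.+1) : pi_at pi i%:Z = pi 0 i.
Proof. by rewrite /pi_at valK. Qed.

Lemma pi_at_ge0 (k : int) : 0 <= pi_at pi k.
Proof. by case: k => [m|m] //=; case: insubP => //= i _ _; apply: ltW. Qed.

Lemma pi_at_succ (i : 'I_n.+1) : pi_at pi (i%:Z + 1) = pi_at pi i.+1%:Z.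
Proof. by congr pi_at; lia. Qed.

Lemma pi_at_out (m : nat) : (n < m)%N -> pi_at pi m%:Z = 0.
Proof. by move=> lt_nm; rewrite /pi_at insubF // ltnS leqNgt lt_nm. Qed.

Lemma pi_at_neg : pi_at pi (0%:Z - 1) = 0.
Proof. by []. Qed.

(** One formula covers births and deaths: pi_i K i j is then visibly symmetric
    in i and j, and K i j + K j i = 1 for neighbours. *)
Lemma K_of_adj (i j : 'I_n.+1) :
  ((j == i.+1 :> nat) || (i == j.+1 :> nat)) ->
  K_of pi i j = pi 0 j / (pi 0 i + pi 0 j).
Proof.
case/orP => /eqP ij; rewrite mxE.
  have -> : (j.+1 == i :> nat) = false by apply/negbTE; lia.
  have -> : (j == i) = false by apply/negbTE; rewrite -val_eqE /=; lia.
  rewrite ij eqxx.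
  by rewrite /birth_prob pi_at_succ -ij !pi_at_ord.
rewrite ij eqxx /death_prob -ij pi_at_ord.
have -> : i%:Z - 1 = j%:Z by lia.
by rewrite pi_at_ord addrC.
Qed.

Lemma K_of_far (i j : 'I_n.+1) :
  ((i.+1 < j) || (j.+1 < i))%N -> K_of pi i j = 0.
Proof.
by move=> far; rewrite mxE !ifF //; apply/negbTE; rewrite -?val_eqE /=; lia.
Qed.

Lemma K_of_reversible : reversible pi (K_of pi).
Proof.
move=> i j; have [far | near] := boolP ((i.+1 < j) || (j.+1 < i))%N.
  by rewrite !K_of_far ?mulr0 // orbC.
have [-> // | ne_ij] := eqVneq i j.
have adj : (j == i.+1 :> nat) || (i == j.+1 :> nat).
  by move: ne_ij near; rewrite -val_eqE /=; lia.
rewrite !K_of_adj //; last by rewrite orbC.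
by rewrite [pi 0 j + _]addrC mulrCA.
Qed.

Lemma K_of_row_sum (i : 'I_n.+1) : \sum_j K_of pi i j = 1.
Proof.
(* Outside {0, ..., n} the value is 0, so an absent neighbour adds nothing. *)
have pick (m : nat) c : ((n < m)%N -> c = 0) ->
    \sum_(j < n.+1) (j == m :> nat)%:R * c = c :> R.
  move=> c0; case: (ltnP n m) => [/c0 -> | le_mn].
    by rewrite big1 // => j _; rewrite mulr0.
  rewrite (bigD1 (Ordinal (le_mn : (m < n.+1)%N))) //= eqxx mul1r big1 ?addr0 //.
  by move=> j; rewrite -val_eqE /= => /negbTE ->; rewrite mul0r.
have death : \sum_(j < n.+1) (j.+1 == i :> nat)%:R * death_prob pi i%:Z =
    death_prob pi i%:Z.
  case: i => [[|m] lt_m] /=; last by apply: pick; lia.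
  have -> : death_prob pi 0%:Z = 0 by rewrite /death_prob pi_at_neg mul0r.
  by rewrite big1 // => j _; rewrite mulr0.
have hold : \sum_(j < n.+1) (j == i :> nat)%:R * hold_prob pi i%:Z =
    hold_prob pi i%:Z by apply: pick; have := ltn_ord i; lia.
have birth : \sum_(j < n.+1) (j == i.+1 :> nat)%:R * birth_prob pi i%:Z =
    birth_prob pi i%:Z.
  by apply: pick => lt_ni; rewrite /birth_prob pi_at_succ pi_at_out // mul0r.
have -> : \sum_j K_of pi i j =
    death_prob pi i%:Z + hold_prob pi i%:Z + birth_prob pi i%:Z.
  rewrite -{1}death -{1}hold -{1}birth -!big_split /=.
  apply: eq_bigr => j _; rewrite mxE -(inj_eq val_inj) /=.
  case: (eqVneq j.+1 i) => [e1|_].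
    have -> : (j == i :> nat) = false by apply/negbTE; lia.
    have -> : (j == i.+1 :> nat) = false by apply/negbTE; lia.
    by rewrite mul1r !mul0r !addr0.
  case: (eqVneq (j : nat) i) => [e2|_].
    have -> : (j == i.+1 :> nat) = false by apply/negbTE; lia.
    by rewrite mul1r !mul0r add0r addr0.
  by case: eqP => _; rewrite ?mul1r !mul0r !add0r.
rewrite /death_prob /hold_prob /birth_prob pi_at_ord.
have := pi_gt0 i; have := pi_at_ge0 (i%:Z - 1); have := pi_at_ge0 (i%:Z + 1).
move=> c_ge0 a_ge0 b_gt0; field.
by apply/andP; split; apply: lt0r_neq0; lra.
Qed.

Hypothesis pi_lc : log_concave pi.

(** The convention pi_(-1) = pi_(n+1) = 0 extends log-concavity from the
    interior to the two end points, where the left-hand side vanishes. *)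
Lemma log_concave_pi_at (i : 'I_n.+1) :
  pi_at pi (i%:Z - 1) * pi_at pi (i%:Z + 1) <= pi_at pi i%:Z ^+ 2.
Proof.
have [in_i | end_i] := boolP (0 < i < n)%N; first exact: pi_lc.
have := ltn_ord i; case: (posnP i) => [-> _ | i_gt0 lt_in].
  by rewrite pi_at_neg mul0r sqr_ge0.
by rewrite pi_at_succ pi_at_out ?mulr0 ?sqr_ge0 //; lia.
Qed.

Lemma K_of_birth_death : birth_death (K_of pi).
Proof.
split; last by move=> i j far; apply: K_of_far; lia.
split=> [i j|]; last exact: K_of_row_sum.
have nn := pi_at_ge0.
rewrite mxE; do ![case: ifP => _] => //.
- by rewrite divr_ge0 ?addr_ge0.
- apply: divr_ge0; first by rewrite subr_ge0 log_concave_pi_at.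
  by rewrite mulr_ge0 ?addr_ge0.
by rewrite divr_ge0 ?addr_ge0.
Qed.

Lemma K_of_stoch_monotone : stoch_monotone (K_of pi).
Proof.
apply: birth_death_stoch_monotone K_of_birth_death _ => i j ji.
rewrite !K_of_adj ?ji ?eqxx ?orbT // [pi 0 j + _]addrC -mulrDl [pi 0 j + _]addrC.
by rewrite divff // gt_eqF ?addr_gt0.
Qed.

(** Multiplying K i j + K j i <= 1 by pi_j and using reversibility gives
    K i j (pi_i + pi_j) <= pi_j. *)
Lemma stoch_monotone_le_K_of (K : 'M[R]_n.+1) :
  birth_death K -> stoch_monotone K -> reversible pi K ->
  forall i j, i != j -> K i j <= K_of pi i j.
Proof.
move=> bdK smK rK i j ne_ij.
have [far | near] := boolP ((i.+1 < j) || (j.+1 < i))%N.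
  by rewrite K_of_far // (birth_death_far bdK).
rewrite K_of_adj; last by move: ne_ij near; rewrite -val_eqE /=; lia.
rewrite ler_pdivlMr ?addr_gt0 // mulrDr mulrC rK.
have := stoch_monotone_add_le1 (proj1 bdK) smK ne_ij.
have := pi_gt0 j; nra.
Qed.

End ExtremalKernel.

Theorem theorem5p1 (R : realFieldType) (n : nat) (n_gt0 : (0 < n)%N)
    (pi : 'rV[R]_n.+1) (pi_pmf : positive_pmf pi) (pi_lc : log_concave pi) :
  [/\ birth_death (K_of pi),
      stoch_monotone (K_of pi),
      stationary pi (K_of pi) &
      forall K : 'M[R]_n.+1,
        birth_death K -> stoch_monotone K -> stationary pi K ->
        kernel_le pi (K_of pi) K].
Proof.
have [pi_gt0 _] := pi_pmf.
have bdpi := K_of_birth_death pi_gt0 pi_lc.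
have rpi := K_of_reversible pi.
split=> // [||K bdK smK sK].
- exact: K_of_stoch_monotone.
- exact: reversible_stationary (proj1 bdpi) rpi.
have rK := stationary_birth_death_reversible bdK sK.
apply: (reversible_kernel_le _ (proj1 bdpi) rpi (proj1 bdK) rK).
  by move=> i; apply: ltW.
exact: stoch_monotone_le_K_of.
Qed.
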